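(* Let $\mathscr{A}$ be an abelian category, let $\mathscr{C}$ be an additive subcategory of $\mathscr{A}$ closed under extensions, and let $\mathscr{X}$ be a generator-cogenerator for $\mathscr{C}$. Then the following statements are equivalent for any object $M$ in $\mathscr{A}$ and any $n\geq 0$. (1) $\mathscr{C}\text{-}\dim M\leq n$. (2) There exists an exact sequence $0\to C_n\to X_{n-1}\to\cdots\to X_1\to X_0\to M\to 0$ in $\mathscr{A}$ with $C_n$ an object in $\mathscr{C}$ and all $X_i$ objects in $\mathscr{X}$. (3) There exists an exact sequence $0\to X_n\to X_{n-1}\to\cdots\to X_1\to C_0\to M\to 0$ in $\mathscr{A}$ with $C_0$ an object in $\mathscr{C}$ and all $X_i$ objects in $\mathscr{X}$. (4) For every integer $t$ with $0\leq t\leq n$, there exists an exact sequence $0\to X_n\to\cdots\to X_1\to X_0\to M\to 0$ in $\mathscr{A}$ such that $X_t$ is an object in $\mathscr{C}$ and all $X_i$ with $i\neq t$ are objects in $\mathscr{X}$.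
   Context: All subcategories are full, closed under isomorphisms, and additive, i.e. closed under finite direct sums (in particular containing the zero object). $\mathscr{C}\text{-}\dim M$ is the infimum of the integers $n\geq 0$ for which there exists an exact sequence $0\to C_n\to\cdots\to C_1\to C_0\to M\to 0$ in $\mathscr{A}$ with all $C_i$ in $\mathscr{C}$ (and is infinity if no such $n$ exists). A subcategory $\mathscr{X}$ of $\mathscr{C}$ is a generator (resp. cogenerator) for $\mathscr{C}$ if for every object $C$ in $\mathscr{C}$ there is an exact sequence $0\to C'\to X\to C\to 0$ (resp. $0\to C\to X\to C'\to 0$) with $X$ in $\mathscr{X}$ and $C'$ in $\mathscr{C}$; it is a generator-cogenerator for $\mathscr{C}$ if it is both a generator and a cogenerator for $\mathscr{C}$. *)

(* Defs.v *)
From mathcomp Require Import all_boot all_algebra.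
From mathcomp Require Import boolp.

Set Implicit Arguments.
Unset Strict Implicit.
Unset Printing Implicit Defensive.

Import GRing.Theory.
Local Open Scope ring_scope.

Declare Scope cat_scope.
Delimit Scope cat_scope with cat.
Local Open Scope cat_scope.

(* [mcomp g f] is "g after f". *)
Record preadditiveCat := PreadditiveCat {
  obj :> Type;
  hom : obj -> obj -> zmodType;
  idm : forall X : obj, hom X X;
  mcomp : forall X Y Z : obj, hom Y Z -> hom X Y -> hom X Z;
  mcompA : forall (W X Y Z : obj) (h : hom Y Z) (g : hom X Y) (f : hom W X),
    mcomp h (mcomp g f) = mcomp (mcomp h g) f;
  mcomp1m : forall (X Y : obj) (f : hom X Y), mcomp (idm Y) f = f;
  mcompm1 : forall (X Y : obj) (f : hom X Y), mcomp f (idm X) = f;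
  mcompDl : forall (X Y Z : obj) (g h : hom Y Z) (f : hom X Y),
    mcomp (g + h) f = mcomp g f + mcomp h f;
  mcompDr : forall (X Y Z : obj) (g : hom Y Z) (f h : hom X Y),
    mcomp g (f + h) = mcomp g f + mcomp g h
}.

Arguments hom {p} X Y.
Arguments idm {p} X.
Arguments mcomp {p X Y Z} g f.

Notation "g \co f" := (mcomp g f)
  (at level 40, left associativity) : cat_scope.

Section Preadditive.
Variable A : preadditiveCat.
Implicit Types X Y Z W : A.

Definition monic X Y (f : hom X Y) : Prop :=
  forall W (u v : hom W X), f \co u = f \co v -> u = v.

Definition epic X Y (f : hom X Y) : Prop :=
  forall W (u v : hom Y W), u \co f = v \co f -> u = v.

Definition isomorphic X Y : Prop :=
  exists (f : hom X Y) (g : hom Y X), g \co f = idm X /\ f \co g = idm Y.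

Definition is_zero_object Z : Prop :=
  (forall X (f : hom X Z), f = 0) /\ (forall X (f : hom Z X), f = 0).

Definition is_kernel K X Y (k : hom K X) (f : hom X Y) : Prop :=
  f \co k = 0 /\
  forall W (u : hom W X), f \co u = 0 -> exists! v : hom W K, k \co v = u.

Definition is_cokernel X Y Q (q : hom Y Q) (f : hom X Y) : Prop :=
  q \co f = 0 /\
  forall W (u : hom Y W), u \co f = 0 -> exists! v : hom Q W, v \co q = u.

Definition is_direct_sum (n : nat) (F : 'I_n -> A) S : Prop :=
  exists (inj : forall i, hom (F i) S) (proj : forall i, hom S (F i)),
    [/\ forall i, proj i \co inj i = idm (F i),
        forall i j, i != j -> proj j \co inj i = 0
      & \sum_(i < n) inj i \co proj i = idm S].

(* The image of [f] is the kernel of its cokernel. *)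
Definition is_image I X Y (m : hom I Y) (f : hom X Y) : Prop :=
  exists Q (q : hom Y Q), is_cokernel q f /\ is_kernel m q.

(* Im f = Ker g: one subobject of Y is both an image of f and a kernel of g. *)
Definition exact X Y Z (f : hom X Y) (g : hom Y Z) : Prop :=
  exists I (m : hom I Y), is_image m f /\ is_kernel m g.

End Preadditive.

Record abelianCat := AbelianCat {
  abelian_base :> preadditiveCat;
  zero_object : abelian_base;
  zero_objectP : is_zero_object zero_object;
  direct_sum_ex : forall (n : nat) (F : 'I_n -> abelian_base),
    exists S : abelian_base, is_direct_sum F S;
  kernel_ex : forall (X Y : abelian_base) (f : hom X Y),
    exists (K : abelian_base) (k : hom K X), is_kernel k f;
  cokernel_ex : forall (X Y : abelian_base) (f : hom X Y),
    exists (Q : abelian_base) (q : hom Y Q), is_cokernel q f;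
  monic_normal : forall (X Y : abelian_base) (f : hom X Y), monic f ->
    exists (Z : abelian_base) (g : hom Y Z), is_kernel f g;
  epic_normal : forall (X Y : abelian_base) (f : hom X Y), epic f ->
    exists (W : abelian_base) (g : hom W X), is_cokernel f g
}.

Arguments zero_object {a}.

Section Abelian.
Variable A : abelianCat.

(* 0 -> X -> Y -> Z -> 0 *)
Definition short_exact (X Y Z : A) (f : hom X Y) (g : hom Y Z) : Prop :=
  [/\ exact (0 : hom zero_object X) f, exact f g
    & exact g (0 : hom Z zero_object)].

(* A full subcategory is given by its class of objects. *)
Definition additive_subcategory (C : A -> Prop) : Prop :=
  (forall X Y : A, isomorphic X Y -> C X -> C Y) /\
  (forall (n : nat) (F : 'I_n -> A) (S : A),
     is_direct_sum F S -> (forall i, C (F i)) -> C S).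

Definition closed_under_extensions (C : A -> Prop) : Prop :=
  forall (X Y Z : A) (f : hom X Y) (g : hom Y Z),
    short_exact f g -> C X -> C Z -> C Y.

Definition generator (X C : A -> Prop) : Prop :=
  forall M : A, C M -> exists (C' X0 : A) (f : hom C' X0) (g : hom X0 M),
    [/\ short_exact f g, X X0 & C C'].

Definition cogenerator (X C : A -> Prop) : Prop :=
  forall M : A, C M -> exists (X0 C' : A) (f : hom M X0) (g : hom X0 C'),
    [/\ short_exact f g, X X0 & C C'].

Definition generator_cogenerator (X C : A -> Prop) : Prop :=
  generator X C /\ cogenerator X C.

Definition augment (M : A) (Y : nat -> A) (i : nat) : A :=
  if i is j.+1 then Y j else M.

(* 0 -> Y n -> ... -> Y 1 -> Y 0 -> M -> 0, where [d 0 : Y 0 -> M] and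
   [d i.+1 : Y i.+1 -> Y i]; nothing is asked of [Y i] and [d i] for i > n. *)
Definition exact_sequence (n : nat) (Y : nat -> A) (M : A) : Prop :=
  exists d : forall i, hom (augment M Y i.+1) (augment M Y i),
    [/\ exact (0 : hom zero_object (augment M Y n.+1)) (d n),
        forall i, (i < n)%N -> exact (d i.+1) (d i)
      & exact (d 0%N) (0 : hom (augment M Y 0) zero_object)].

Definition has_resolution (C : A -> Prop) (M : A) (n : nat) : Prop :=
  exists Y : nat -> A,
    exact_sequence n Y M /\ forall i, (i <= n)%N -> C (Y i).

(* [None] stands for infinity, the infimum of the empty set. *)
Definition resolution_dim (C : A -> Prop) (M : A) : option nat :=
  match pselect (exists n, `[< has_resolution C M n >]) with
  | left h => Some (ex_minn h)
  | right _ => None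
  end.

End Abelian.

Definition dim_le (d : option nat) (n : nat) : Prop :=
  if d is Some m then (m <= n)%N else False.

(* Main.v *)
Require Import Defs.
From mathcomp Require Import all_boot all_algebra.
From mathcomp Require Import boolp.
Import Defs.

Set Implicit Arguments.
Unset Strict Implicit.
Unset Printing Implicit Defensive.

Import GRing.Theory.
Local Open Scope ring_scope.
Local Open Scope cat_scope.

(** Everything reduces to one exchange move on two consecutive terms of a long
    exact sequence. If [W -> Y1 -> Y0 -> V] is exact with [Y1] and [Y0] in [C],
    choose [0 -> C' -> X0 -> Y0 -> 0] with [X0] in [X] and [C'] in [C], and
    pull [X0 -> Y0] back along [Y1 -> Y0]. The pullback [P] is an extension of
    [Y1] by [C'], so it is in [C], and [W -> P -> X0 -> V] is exact, with the
    kernel at [W] and the cokernel at [V] unchanged (lemma [exchange_up]).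
    The cogenerator yields the dual move, which puts an object of [X] in place
    of [Y1] and one of [C] in place of [Y0]; it is obtained by reading the first
    move in the opposite category (lemma [exchange_down]). As the kernel at [W]
    and the cokernel at [V] are unchanged, a move can be made inside a
    resolution without touching the other terms (lemma [resolves_exchange]).

    Given a resolution by objects of [C], padded with zero objects up to
    length [n], upward moves at degrees [0, 1, ..., n-1] leave objects of [X]
    behind and a single object of [C] in degree [n]. Downward moves bring that
    object from degree [n] to degree [0], since [X] is contained in [C], and
    upward moves then take it from degree [0] to any degree [t]. Conversely a
    sequence of this last kind, for [t = 0], is already a resolution of
    length [n] by objects of [C].

    The diagram chases use lifts along epimorphisms as a substitute for
    elements: by [exact_lift] and [lift_exact], [X -> Y -> Z] is exact when the
    composite vanishes and every generalized element [T -> Y] killed by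
    [Y -> Z] comes from [X] after an epimorphism onto [T]. *)

(** * Composition in a preadditive category *)

Section Preadditive.
Variable A : preadditiveCat.
Implicit Types X Y Z W : A.

Lemma mcompm0 X Y Z (g : hom Y Z) : g \co (0 : hom X Y) = 0.
Proof. by apply: (addrI (g \co (0 : hom X Y))); rewrite -mcompDr !addr0. Qed.

Lemma mcomp0m X Y Z (f : hom X Y) : (0 : hom Y Z) \co f = 0.
Proof. by apply: (addrI ((0 : hom Y Z) \co f)); rewrite -mcompDl !addr0. Qed.

Lemma mcompmN X Y Z (g : hom Y Z) (f : hom X Y) : g \co (- f) = - (g \co f).
Proof. by apply: (addrI (g \co f)); rewrite -mcompDr !subrr mcompm0. Qed.

Lemma mcompNm X Y Z (g : hom Y Z) (f : hom X Y) : (- g) \co f = - (g \co f).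
Proof. by apply: (addrI (g \co f)); rewrite -mcompDl !subrr mcomp0m. Qed.

Lemma epicP X Y (f : hom X Y) :
  epic f <-> forall Z (u : hom Y Z), u \co f = 0 -> u = 0.
Proof.
split=> [epi_f Z u uf0 | epi_f Z u v uf_vf].
  by apply: epi_f; rewrite uf0 mcomp0m.
apply/eqP; rewrite -subr_eq0; apply/eqP; apply: epi_f.
by rewrite mcompDl mcompNm uf_vf subrr.
Qed.

Lemma epic_comp X Y Z (g : hom Y Z) (f : hom X Y) :
  epic g -> epic f -> epic (g \co f).
Proof.
by move=> epi_g epi_f W u v; rewrite !mcompA => /epi_f /epi_g.
Qed.

Lemma is_kernel_monic X Y K (k : hom K X) (f : hom X Y) :
  is_kernel k f -> monic k.
Proof.
move=> [fk0 ker_k] W u v ku_kv.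
have [w [_ uniq_w]] : exists! w, k \co w = k \co u.
  by apply: ker_k; rewrite mcompA fk0 mcomp0m.
by rewrite -(uniq_w _ erefl); apply: uniq_w.
Qed.

Lemma kernel_factor X Y K (k : hom K X) (f : hom X Y) W (u : hom W X) :
  is_kernel k f -> f \co u = 0 -> exists v, k \co v = u.
Proof. by case=> _ ker_k /ker_k[v [kv _]]; exists v. Qed.

Lemma cokernel_factor X Y Q (q : hom Y Q) (f : hom X Y) W (u : hom Y W) :
  is_cokernel q f -> u \co f = 0 -> exists v, v \co q = u.
Proof. by case=> _ coker_q /coker_q[v [vq _]]; exists v. Qed.

Definition is_pullback P X Y Z (pX : hom P X) (pY : hom P Y)
    (f : hom X Z) (g : hom Y Z) : Prop :=
  [/\ f \co pX = g \co pY,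
      forall T (u v : hom T P),
        pX \co u = pX \co v -> pY \co u = pY \co v -> u = v
    & forall T (u : hom T X) (v : hom T Y), f \co u = g \co v ->
        exists w : hom T P, pX \co w = u /\ pY \co w = v].

(** Exactness at the source of [a] depends on [a] only through the maps it
    kills, so comparing annihilators replaces choosing an isomorphism between
    kernels, and dually for cokernels. *)
Definition same_ker W Y Y' (a : hom W Y) (a' : hom W Y') : Prop :=
  forall T (v : hom T W), a \co v = 0 <-> a' \co v = 0.

Definition same_coker Y Y' V (c : hom Y V) (c' : hom Y' V) : Prop :=
  forall T (w : hom V T), w \co c = 0 <-> w \co c' = 0.

End Preadditive.

(** * Exactness in an abelian category *)

Section Exactness.
Variable A : abelianCat.
Implicit Types T W X Y Z : A.

(** This form of exactness mentions neither images nor kernels, and exchanging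
    [f] with [g] and [v] with [w] turns it into its own dual. It is how
    exactness passes to the opposite category. *)
Lemma exactP X Y Z (f : hom X Y) (g : hom Y Z) :
  exact f g <->
  g \co f = 0 /\ forall T S (v : hom T Y) (w : hom Y S),
    g \co v = 0 -> w \co f = 0 -> w \co v = 0.
Proof.
split=> [[I [m [[Q [q [coker_q ker_q]]] ker_g]]] | [gf0 wv0]].
  split=> [|T S v w gv0 wf0].
    have [u <-] : exists u, m \co u = f.
      by apply: (kernel_factor ker_q); case: coker_q.
    by rewrite mcompA; case: ker_g => -> _; rewrite mcomp0m.
  have [u <-] := kernel_factor ker_g gv0.
  have [s <-] := cokernel_factor coker_q wf0.
  by rewrite -mcompA (mcompA q); case: ker_q => -> _; rewrite mcomp0m mcompm0.
have [Q [q coker_q]] := cokernel_ex f.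
have [I [m ker_q]] := kernel_ex q.
exists I, m; split; first by exists Q, q.
split=> [|T v gv0].
  have [s <-] := cokernel_factor coker_q gf0.
  by rewrite -mcompA; case: ker_q => -> _; rewrite mcompm0.
by case: ker_q => _; apply; apply: wv0 gv0 _; case: coker_q.
Qed.

Lemma exact_comp0 X Y Z (f : hom X Y) (g : hom Y Z) : exact f g -> g \co f = 0.
Proof. by case/exactP. Qed.

Lemma exact_same_ker X Y Z Z' (f : hom X Y) (g : hom Y Z) (g' : hom Y Z') :
  same_ker g g' -> exact f g -> exact f g'.
Proof.
move=> gg' /exactP[gf0 wv0]; apply/exactP; split; first exact/gg'.
by move=> T S v w /gg'; apply: wv0.
Qed.

Lemma exact_same_coker X X' Y Z (f : hom X Y) (f' : hom X' Y) (g : hom Y Z) :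
  same_coker f f' -> exact f g -> exact f' g.
Proof.
move=> ff' /exactP[gf0 wv0]; apply/exactP; split; first exact/ff'.
by move=> T S v w gv0 /ff'; apply: wv0.
Qed.

Lemma zero_source W (f : hom (zero_object : A) W) : f = 0.
Proof. by case: (@zero_objectP A) => _; apply. Qed.

Lemma exact_zero_object W : exact (0 : hom (zero_object : A) zero_object)
  (0 : hom zero_object W).
Proof.
apply/exactP; split=> [|T S v w _ _]; first by rewrite mcompm0.
by rewrite (zero_source w) mcomp0m.
Qed.

Lemma zero_direct_sum (F : 'I_0 -> A) : is_direct_sum F (zero_object : A).
Proof.
exists (fun=> 0), (fun=> 0); split; try by case.
by rewrite big_ord0; apply/esym/zero_source.
Qed.

Lemma biproduct_ex X Y : exists (S : A) (iX : hom X S) (iY : hom Y S)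
    (pX : hom S X) (pY : hom S Y),
  [/\ pX \co iX = idm X, pY \co iY = idm Y, pY \co iX = 0, pX \co iY = 0
    & iX \co pX + iY \co pY = idm S].
Proof.
pose F (i : 'I_2) := if val i == 0%N then X else Y.
have [S [inj [proj [pi_id pi_0 sum_ip]]]] := direct_sum_ex F.
pose i0 : 'I_2 := ord0; pose i1 : 'I_2 := lift ord0 ord0.
exists S, (inj i0), (inj i1), (proj i0), (proj i1); split.
- exact: (pi_id i0).
- exact: (pi_id i1).
- exact: (pi_0 i0 i1).
- exact: (pi_0 i1 i0).
- by rewrite -sum_ip big_ord_recl big_ord1.
Qed.

Lemma epic_cokernel X Y K (f : hom X Y) (k : hom K X) :
  epic f -> is_kernel k f ->
  forall W (u : hom X W), u \co k = 0 -> exists v, v \co f = u.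
Proof.
move=> /epic_normal[V [g coker_f]] ker_k W u uk0.
apply: (cokernel_factor coker_f).
have [h <-] : exists h, k \co h = g.
  by apply: (kernel_factor ker_k); case: coker_f.
by rewrite mcompA uk0 mcomp0m.
Qed.

(** The pullback is the kernel of [d = f pX - g pY] on the biproduct. When [g]
    is epic so is [d], which is then the cokernel of that kernel: a map [u pX]
    that kills the kernel factors as [h d], restricting to [Y] gives
    [h g = 0], and so [h = 0] and [u = 0]. *)
Lemma pullback_ex X Y Z (f : hom X Z) (g : hom Y Z) :
  exists (P : A) (pX : hom P X) (pY : hom P Y),
    is_pullback pX pY f g /\ (epic g -> epic pX).
Proof.
have [S [iX [iY [pX [pY [pXiX pYiY pYiX pXiY ip_id]]]]]] := biproduct_ex X Y.
pose d := f \co pX - g \co pY.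
have dE T (u : hom T S) : d \co u = f \co (pX \co u) - g \co (pY \co u).
  by rewrite /d mcompDl mcompNm !mcompA.
have [P [k ker_k]] := kernel_ex d.
exists P, (pX \co k), (pY \co k); split; first split.
- apply/eqP; rewrite -subr_eq0 -dE; case: ker_k => -> _; exact: eqxx.
- move=> T u v; rewrite -!mcompA => pXuv pYuv.
  apply: (is_kernel_monic ker_k).
  rewrite -[k \co u]mcomp1m -[k \co v]mcomp1m -ip_id !mcompDl -!mcompA.
  by rewrite pXuv pYuv.
- move=> T u v fu_gv.
  have pXw : pX \co (iX \co u + iY \co v) = u.
    by rewrite mcompDr !mcompA pXiX pXiY mcomp1m mcomp0m addr0.
  have pYw : pY \co (iX \co u + iY \co v) = v.
    by rewrite mcompDr !mcompA pYiX pYiY mcomp1m mcomp0m add0r.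
  have [w kw] : exists w, k \co w = iX \co u + iY \co v.
    by apply: (kernel_factor ker_k); rewrite dE pXw pYw fu_gv subrr.
  by exists w; rewrite -!mcompA kw.
- move=> /epicP epi_g; apply/epicP => W u; rewrite mcompA => uk0.
  have diY : d \co iY = - g by rewrite dE pXiY pYiY mcompm0 mcompm1 add0r.
  have epi_d : epic d.
    apply/epicP => V s sd0; apply: epi_g; apply: oppr_inj.
    by rewrite -mcompmN -diY mcompA sd0 mcomp0m oppr0.
  have [h hd] := epic_cokernel epi_d ker_k uk0.
  have h0 : h = 0.
    apply: epi_g; apply: oppr_inj.
    by rewrite -mcompmN -diY mcompA hd -mcompA pXiY mcompm0 oppr0.
  by rewrite -[u]mcompm1 -pXiX mcompA -hd h0 !mcomp0m.
Qed.

Lemma epic_lift X Y T (f : hom X Y) (v : hom T Y) : epic f ->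
  exists (T' : A) (e : hom T' T) (u : hom T' X), epic e /\ v \co e = f \co u.
Proof.
move=> epi_f; have [P [e [u [[comm _ _] epi_e]]]] := pullback_ex v f.
by exists P, e, u; split; first exact: epi_e.
Qed.

(** If [u f' = 0] then [f] factors through the subobject [m (ker u)]. Being
    normal, this subobject is the kernel of some [h] with [h f = 0], so [h]
    factors through the cokernel of [f] and kills the whole image [m]. Thus
    [ker u] is split epic, and [u = 0]. *)
Lemma image_epic X Y I Q (f : hom X Y) (m : hom I Y) (q : hom Y Q)
    (f' : hom X I) :
  is_cokernel q f -> is_kernel m q -> m \co f' = f -> epic f'.
Proof.
move=> coker_q ker_q mf'; apply/epicP => W u uf'0.
have [K [k ker_k]] := kernel_ex u.
have [f'' kf''] := kernel_factor ker_k uf'0.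
have mono_m := is_kernel_monic ker_q.
have mono_mk : monic (m \co k).
  move=> V s t; rewrite -!mcompA => /mono_m.
  exact: (is_kernel_monic ker_k).
have [Z [h ker_h]] := monic_normal mono_mk.
have hm0 : h \co m = 0.
  have [h' <-] : exists h', h' \co q = h.
    apply: (cokernel_factor coker_q).
    rewrite -mf' -kf'' (mcompA m) mcompA.
    by case: ker_h => -> _; rewrite mcomp0m.
  by rewrite -mcompA; case: ker_q => -> _; rewrite mcompm0.
have [s mks] := kernel_factor ker_h hm0.
have ks1 : k \co s = idm I by apply: mono_m; rewrite mcompA mks mcompm1.
rewrite -[u]mcompm1 -ks1 mcompA.
by case: ker_k => -> _; rewrite mcomp0m.
Qed.

(** [v] factors through the image of [f], onto which [f] is epic; the change of
    domain [e] is a pullback of that epimorphism. *)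
Lemma exact_lift X Y Z T (f : hom X Y) (g : hom Y Z) (v : hom T Y) :
  exact f g -> g \co v = 0 ->
  exists (T' : A) (e : hom T' T) (u : hom T' X), epic e /\ v \co e = f \co u.
Proof.
case=> I [m [[Q [q [coker_q ker_q]]] ker_g]] gv0.
have [v' mv'] := kernel_factor ker_g gv0.
have [f' mf'] : exists f', m \co f' = f.
  by apply: (kernel_factor ker_q); case: coker_q.
have epi_f' := image_epic coker_q ker_q mf'.
have [T' [e [u [epi_e v'e]]]] := epic_lift v' epi_f'.
by exists T', e, u; split=> //; rewrite -mv' -mf' -!mcompA v'e.
Qed.

Lemma lift_exact X Y Z (f : hom X Y) (g : hom Y Z) :
  g \co f = 0 ->
  (forall T (v : hom T Y), g \co v = 0 -> exists (T' : A) (e : hom T' T)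
     (u : hom T' X), epic e /\ v \co e = f \co u) ->
  exact f g.
Proof.
move=> gf0 lift_f; apply/exactP; split=> // T S v w /lift_f.
move=> [T' [e [u [/epicP epi_e ve_fu]]]] wf0; apply: epi_e.
by rewrite -mcompA ve_fu mcompA wf0 mcomp0m.
Qed.

End Exactness.

(** * The opposite category *)

Section Opposite.
Variable A : abelianCat.

(** The opposite category is built transparently so that its objects, maps and
    composition reduce to those of [A]; statements about it can then be read
    in [A] by conversion. *)
Definition op_preadditive : preadditiveCat.
Proof.
refine (@PreadditiveCat A (fun X Y => hom Y X) idm
          (fun X Y Z g f => f \co g) _ _ _ _ _) => /=.
- by move=> *; rewrite mcompA.
- by move=> *; rewrite mcompm1.
- by move=> *; rewrite mcomp1m.
- by move=> *; rewrite mcompDr.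
- by move=> *; rewrite mcompDl.
Defined.

Definition op_abelian : abelianCat.
Proof.
refine (@AbelianCat op_preadditive (zero_object : A) _ _ _ _ _ _).
- by case: (@zero_objectP A) => to0 from0; split.
- move=> n F; have [S [inj [proj [pi_id pi_0 sum_ip]]]] := @direct_sum_ex A n F.
  by exists S, proj, inj; split=> // i j neq_ij; apply: pi_0; rewrite eq_sym.
- by move=> X Y f; apply: (@cokernel_ex A Y X f).
- by move=> X Y f; apply: (@kernel_ex A Y X f).
- by move=> X Y f mono_f; apply: (@epic_normal A Y X f).
- by move=> X Y f epi_f; apply: (@monic_normal A Y X f).
Defined.

Lemma exact_op (X Y Z : A) (f : hom X Y) (g : hom Y Z) :
  exact f g <-> @exact op_abelian Z Y X g f.
Proof.
by split=> /exactP[gf0 wv0]; apply/exactP; split=> // T S v w v0 w0;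
  apply: wv0 w0 v0.
Qed.

Lemma short_exact_op (X Y Z : A) (f : hom X Y) (g : hom Y Z) :
  short_exact f g <-> @short_exact op_abelian Z Y X g f.
Proof.
by split=> -[ex1 ex2 ex3]; split; apply/exact_op.
Qed.

Lemma closed_under_extensions_op (C : A -> Prop) :
  closed_under_extensions C -> @closed_under_extensions op_abelian C.
Proof.
move=> C_ext X Y Z f g /short_exact_op se CX CZ; exact: C_ext se CZ CX.
Qed.

Lemma generator_op (X C : A -> Prop) :
  cogenerator X C -> @generator op_abelian X C.
Proof.
move=> X_cogen M /X_cogen[X0 [C' [f [g [se XX0 CC']]]]].
by exists C', X0, g, f; split=> //; apply/short_exact_op.
Qed.

End Opposite.

(** * Exchanging two consecutive terms *)

(** The annihilator conditions are what keeps the rest of a longer exact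
    sequence exact, and stating them on both sides makes the notion
    self-dual. *)
Definition exchangeable (A : abelianCat) (D1 D0 E1 E0 : A -> Prop) : Prop :=
  forall (W Y1 Y0 V : A) (a : hom W Y1) (b : hom Y1 Y0) (c : hom Y0 V),
    exact a b -> exact b c -> D1 Y1 -> D0 Y0 ->
    exists (Y1' Y0' : A) (a' : hom W Y1') (b' : hom Y1' Y0') (c' : hom Y0' V),
      [/\ E1 Y1' /\ E0 Y0', exact a' b', exact b' c', same_ker a a'
        & same_coker c c'].

(** The new terms are the pullback [P] of [X0 -> Y0] along [Y1 -> Y0] and [X0]
    itself. As [P -> Y1] and [X0 -> Y0] have the same kernel, taken in [C],
    [P] is an extension of [Y1] by an object of [C]. *)
Lemma exchange_up (A : abelianCat) (C X : A -> Prop) :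
  closed_under_extensions C -> generator X C -> exchangeable C C C X.
Proof.
move=> C_ext X_gen W Y1 Y0 V a b c ab bc CY1 CY0.
have [K [X0 [j [p [[j_mono jp p_epi] XX0 CK]]]]] := X_gen _ CY0.
have pj0 := exact_comp0 jp.
have epi_p : epic p.
  apply/epicP => Z u up0; case/exactP: p_epi => _ /(_ _ _ (idm Y0) u).
  by rewrite mcomp0m mcompm1; apply.
have [P [p1 [p0 [[comm p_inj p_ex] _]]]] := pullback_ex b p.
(* [a'] is [(a, 0)] and [j'] is [(0, j)] as maps into the pullback. *)
have [a' [p1a' p0a']] : exists a', p1 \co a' = a /\ p0 \co a' = 0.
  by apply: p_ex; rewrite mcompm0 (exact_comp0 ab).
have [j' [p1j' p0j']] : exists j', p1 \co j' = 0 /\ p0 \co j' = j.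
  by apply: p_ex; rewrite mcompm0 pj0.
exists P, X0, a', p0, (c \co p); split.
- split=> //; apply: (C_ext _ _ _ j' p1) => //; split.
  + apply: exact_same_ker j_mono => T v; split=> [jv0 | j'v0].
      by apply: p_inj; rewrite mcompm0 mcompA ?p1j' ?mcomp0m // p0j'.
    by rewrite -p0j' -mcompA j'v0 mcompm0.
  + apply: lift_exact => // T v p1v0.
    have [|T' [e [u [epi_e p0ve]]]] := exact_lift (v := p0 \co v) jp.
      by rewrite mcompA -comm -mcompA p1v0 mcompm0.
    exists T', e, u; split=> //; apply: p_inj.
      by rewrite !mcompA p1v0 p1j' !mcomp0m.
    by rewrite !mcompA p0j' p0ve.
  + apply: lift_exact => [|T v _]; first by rewrite mcomp0m.
    have [T' [e [u [epi_e bve]]]] := epic_lift (b \co v) epi_p.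
    have [|w [p1w _]] := p_ex _ (v \co e) u; first by rewrite mcompA.
    by exists T', e, w.
- apply: lift_exact => // T v p0v0.
  have [|T' [e [u [epi_e p1ve]]]] := exact_lift (v := p1 \co v) ab.
    by rewrite mcompA comm -mcompA p0v0 mcompm0.
  exists T', e, u; split=> //; apply: p_inj.
    by rewrite !mcompA p1a' p1ve.
  by rewrite !mcompA p0v0 p0a' !mcomp0m.
- apply: lift_exact => [|T v]; rewrite -mcompA.
    by rewrite -comm mcompA (exact_comp0 bc) mcomp0m.
  move=> /(exact_lift bc)[T' [e [u [epi_e pve]]]].
  have [|w [_ p0w]] := p_ex _ u (v \co e); first by rewrite -pve mcompA.
  by exists T', e, w.
- move=> T v; split=> [av0 | a'v0]; last first.
    by rewrite -p1a' -mcompA a'v0 mcompm0.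
  by apply: p_inj; rewrite mcompm0 mcompA ?p0a' ?mcomp0m // p1a'.
- move=> T w; rewrite mcompA; split=> [-> | wcp0]; first by rewrite mcomp0m.
  by apply: epi_p; rewrite wcp0 mcomp0m.
Qed.

Lemma exchange_down (A : abelianCat) (C X : A -> Prop) :
  closed_under_extensions C -> cogenerator X C -> exchangeable C C X C.
Proof.
move=> /closed_under_extensions_op C_ext /generator_op X_gen.
move=> W Y1 Y0 V a b c /exact_op ab /exact_op bc CY1 CY0.
have [Y0' [Y1' [c' [b' [a' [[CY0' XY1'] cb' ba' cc' aa']]]]]] :=
  exchange_up C_ext X_gen bc ab CY0 CY1.
by exists Y1', Y0', a', b', c'; split=> //; apply/exact_op.
Qed.

(** * Resolutions as an inductive predicate *)

(** Exactness of [0 -> Y_(k-1) -> ... -> Y_0 -> M -> Z] with [Y_i] in [P i].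
    Keeping the last map [e : M -> Z] as a parameter, not just its kernel,
    lets the induction pass to the tail of the sequence, which ends in
    [Y_1 -> Y_0 -> M]. There are [k] terms, so a resolution of length [n]
    corresponds to [k = n.+1]. *)
Fixpoint resolves (A : abelianCat) (k : nat) (P : nat -> A -> Prop)
    (M Z : A) (e : hom M Z) : Prop :=
  if k is k'.+1 then
    exists (Y0 : A) (d0 : hom Y0 M),
      [/\ P 0%N Y0, exact d0 e & resolves k' (fun i => P i.+1) d0]
  else exact (0 : hom zero_object M) e.

Section Resolves.
Variable A : abelianCat.
Implicit Types (P Q : nat -> A -> Prop) (M Z : A).

Definition splice M (Y0 : A) (Y : nat -> A) (d0 : hom Y0 M)
    (d : forall i, hom (augment Y0 Y i.+1) (augment Y0 Y i)) i :
    hom (augment M (augment Y0 Y) i.+1) (augment M (augment Y0 Y) i) :=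
  match i with 0%N => d0 | j.+1 => d j end.

Lemma augment_resolves n P M Z (e : hom M Z) :
  (exists (Y : nat -> A) (d : forall i, hom (augment M Y i.+1) (augment M Y i)),
     [/\ exact (0 : hom zero_object (augment M Y n.+1)) (d n),
         forall i, (i < n)%N -> exact (d i.+1) (d i), exact (d 0%N) e
       & forall i, (i <= n)%N -> P i (Y i)]) <->
  resolves n.+1 P e.
Proof.
split=> [[Y [d [exn exi ex0 PY]]] | ].
  elim: n P M Z e Y d exn exi ex0 PY => [|n IHn] P M Z e Y d exn exi ex0 PY.
    by exists (Y 0%N), (d 0%N); split=> //; apply: PY.
  exists (Y 0%N), (d 0%N); split=> //; first exact: PY.
  pose Y' i := Y i.+1.
  pose d' i : hom (augment (Y 0%N) Y' i.+1) (augment (Y 0%N) Y' i) :=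
    match i with 0%N => d 1%N | j.+1 => d j.+2 end.
  apply: (IHn (fun i => P i.+1) _ _ (d 0%N) Y' d').
  - by case: n exn {IHn exi PY}.
  - by case=> [|i] lt_in; [apply: (exi 1%N) | apply: (exi i.+2)].
  - exact: (exi 0%N).
  - by move=> i le_in; apply: PY.
elim: n P M Z e => [|n IHn] P M Z e [Y0 [d0 [PY0 ex0 res]]].
  exists (augment Y0 (fun=> zero_object)).
  exists (splice d0 (fun=> 0)).
  by split=> //; case.
have [Y [d [exn exi ex1 PY]]] := IHn (fun i => P i.+1) _ _ _ res.
exists (augment Y0 Y).
exists (splice d0 d).
by split=> // -[|i] lt_in //; [apply: exi | apply: PY].
Qed.

Lemma exact_sequence_resolves n P M :
  (exists Y : nat -> A,
     exact_sequence n Y M /\ forall i, (i <= n)%N -> P i (Y i)) <->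
  resolves n.+1 P (0 : hom M zero_object).
Proof.
rewrite -augment_resolves; split=> [[Y [[d [exn exi ex0]] PY]] | ].
  by exists Y, d.
by case=> Y [d [exn exi ex0 PY]]; exists Y; split=> //; exists d.
Qed.

Lemma resolves_impl k P Q M Z (e : hom M Z) :
  (forall i Y, (i < k)%N -> P i Y -> Q i Y) -> resolves k P e -> resolves k Q e.
Proof.
elim: k P Q M Z e => //= k IHk P Q M Z e PQ [Y0 [d0 [PY0 ex0 res]]].
exists Y0, d0; split=> //; first exact: PQ.
by apply: IHk res => i Y lt_ik; apply: PQ.
Qed.

Lemma resolves_same_ker k P M Z Z' (e : hom M Z) (e' : hom M Z') :
  same_ker e e' -> resolves k P e -> resolves k P e'.
Proof.
case: k => [|k] ee' /=; first exact: exact_same_ker.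
case=> Y0 [d0 [PY0 ex0 res]]; exists Y0, d0; split=> //.
exact: exact_same_ker ex0.
Qed.

Lemma resolves_pad k l P M Z (e : hom M Z) :
  (forall i, P i zero_object) -> (k <= l)%N -> resolves k P e -> resolves l P e.
Proof.
move=> P0; elim: l k P P0 M Z e => [|l IHl] [|k] P P0 M Z e //= lekl.
  move=> ex0; exists zero_object, 0; split=> //.
  by apply: (IHl 0%N) => //; apply: exact_zero_object.
case=> Y0 [d0 [PY0 ex0 res]]; exists Y0, d0; split=> //.
exact: (IHl k).
Qed.

(** Induction on [t] strips the terms below degree [t]. For [t = 0] the exact
    sequence continues after [Y1] either with a term [W] or with [0]; in the
    latter case the zero object serves as [W]. *)
Lemma resolves_exchange (D1 D0 E1 E0 : A -> Prop) k t P Q M Z (e : hom M Z) :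
  exchangeable D1 D0 E1 E0 -> (t.+1 < k)%N ->
  (forall Y, P t Y -> D0 Y) -> (forall Y, P t.+1 Y -> D1 Y) ->
  (forall Y, E0 Y -> Q t Y) -> (forall Y, E1 Y -> Q t.+1 Y) ->
  (forall i Y, i != t -> i != t.+1 -> P i Y -> Q i Y) ->
  resolves k P e -> resolves k Q e.
Proof.
move=> exch; elim: t k P Q M Z e => [|t IHt] [|k] //=; last first.
  move=> P Q M Z e lt_tk PD0 PD1 EQ0 EQ1 PQ [Y0 [d0 [PY0 ex0 res]]].
  exists Y0, d0; split=> //; first exact: PQ.
  by apply: IHt res => // i Y neq_it neq_it1; apply: PQ.
case: k => [|k] //= P Q M Z e _ PD0 PD1 EQ0 EQ1 PQ.
case=> Y0 [c [PY0 ce [Y1 [b [PY1 bc res]]]]].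
have [D0Y0 D1Y1] := (PD0 _ PY0, PD1 _ PY1).
case: k res => [|k] /=.
  move=> ab; have [Y1' [Y0' [a' [b' [c' [[EY1 EY0] ab' bc' _ cc']]]]]] :=
    exch _ _ _ _ _ _ _ ab bc D1Y1 D0Y0.
  exists Y0', c'; split; [exact: EQ0 | exact: exact_same_coker ce |].
  exists Y1', b'; split=> //; first exact: EQ1.
  by rewrite -(zero_source a').
case=> W [a [PW ab res]].
have [Y1' [Y0' [a' [b' [c' [[EY1 EY0] ab' bc' aa' cc']]]]]] :=
  exch _ _ _ _ _ _ _ ab bc D1Y1 D0Y0.
exists Y0', c'; split; [exact: EQ0 | exact: exact_same_coker ce |].
exists Y1', b'; split=> //; first exact: EQ1.
exists W, a'; split=> //; first exact: PQ.
apply: resolves_same_ker aa' _; apply: resolves_impl res => i Y _; exact: PQ.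
Qed.

End Resolves.

(** * Moving the term of the larger subcategory along a resolution *)

Section Moving.
Variables (A : abelianCat) (C X : A -> Prop).

(** Upward moves on a resolution by objects of [C] pass through the shapes
    [X_below t]; in degrees at most [n], [X_below n] and [X_except n] agree. *)
Definition X_below (t i : nat) : A -> Prop := if (i < t)%N then X else C.

(** The shapes between which a single object of [C] travels. *)
Definition X_except (t i : nat) : A -> Prop := if i == t then C else X.

(** The move at degree [t] turns the terms of degrees [t] and [t.+1], both still
    in [C], into one of [X] and one of [C]. *)
Lemma resolves_X_below n t M Z (e : hom M Z) :
  exchangeable C C C X -> (t <= n)%N ->
  resolves n.+1 (fun=> C) e -> resolves n.+1 (X_below t) e.
Proof.
move=> up; elim: t => [|t IHt] lt_tn res //.
apply: (resolves_exchange up (lt_tn : t.+1 < n.+1)%N) (IHt (ltnW lt_tn) res).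
- by move=> Y; rewrite /X_below ltnn.
- by move=> Y; rewrite /X_below ltnNge leqnSn.
- by move=> Y; rewrite /X_below ltnSn.
- by move=> Y; rewrite /X_below ltnn.
- by move=> i Y neq_it _; rewrite /X_below ltnS (leq_eqVlt i) (negPf neq_it).
Qed.

Hypothesis X_sub_C : forall Y : A, X Y -> C Y.

Lemma resolves_X_except_up n t M Z (e : hom M Z) :
  exchangeable C C C X -> (t < n)%N ->
  resolves n.+1 (X_except t) e -> resolves n.+1 (X_except t.+1) e.
Proof.
move=> up lt_tn; apply: (resolves_exchange up (lt_tn : t.+1 < n.+1)%N).
- by move=> Y; rewrite /X_except eqxx.
- by move=> Y; rewrite /X_except gtn_eqF //; apply: X_sub_C.
- by move=> Y; rewrite /X_except ltn_eqF.
- by move=> Y; rewrite /X_except eqxx.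
- by move=> i Y /negPf neq_it /negPf neq_it1; rewrite /X_except neq_it neq_it1.
Qed.

Lemma resolves_X_except_down n t M Z (e : hom M Z) :
  exchangeable C C X C -> (t < n)%N ->
  resolves n.+1 (X_except t.+1) e -> resolves n.+1 (X_except t) e.
Proof.
move=> down lt_tn; apply: (resolves_exchange down (lt_tn : t.+1 < n.+1)%N).
- by move=> Y; rewrite /X_except ltn_eqF //; apply: X_sub_C.
- by move=> Y; rewrite /X_except eqxx.
- by move=> Y; rewrite /X_except eqxx.
- by move=> Y; rewrite /X_except gtn_eqF.
- by move=> i Y /negPf neq_it /negPf neq_it1; rewrite /X_except neq_it neq_it1.
Qed.

Lemma resolves_X_exceptP n t M : (t <= n)%N ->
  (exists Y : nat -> A,
     [/\ exact_sequence n Y M, C (Y t)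
       & forall i, (i <= n)%N -> i <> t -> X (Y i)]) <->
  resolves n.+1 (X_except t) (0 : hom M zero_object).
Proof.
move=> le_tn; rewrite -exact_sequence_resolves; split=> -[Y].
  case=> exY CYt XY; exists Y; split=> // i le_in.
  by rewrite /X_except; case: eqP => [-> // | /XY]; apply.
case=> exY PY; exists Y; split=> //.
  by have := PY t le_tn; rewrite /X_except eqxx.
move=> i le_in /eqP/negPf neq_it; have := PY i le_in.
by rewrite /X_except neq_it.
Qed.

End Moving.

Lemma dim_leP (A : abelianCat) (C : A -> Prop) (M : A) (n : nat) :
  dim_le (resolution_dim C M) n <->
  exists2 m, (m <= n)%N & has_resolution C M m.
Proof.
rewrite /resolution_dim; case: pselect => [ex_res | no_res] /=.
  case: ex_minnP => m /asboolP res_m min_m.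
  split=> [le_mn | [l le_ln res_l]]; first by exists m.
  by apply: leq_trans le_ln; apply: min_m; apply/asboolP.
by split=> // -[m _ res_m]; apply: no_res; exists m; apply/asboolP.
Qed.

Theorem theorem5p5 (A : abelianCat) (C X : A -> Prop)
    (C_additive : additive_subcategory C)
    (C_ext : closed_under_extensions C)
    (X_additive : additive_subcategory X)
    (X_sub_C : forall M : A, X M -> C M)
    (X_gen_cogen : generator_cogenerator X C)
    (M : A) (n : nat) :
  [<-> dim_le (resolution_dim C M) n;
       exists Y : nat -> A,
         [/\ exact_sequence n Y M, C (Y n)
           & forall i, (i < n)%N -> X (Y i)];
       exists Y : nat -> A,
         [/\ exact_sequence n Y M, C (Y 0%N)
           & forall i, (0 < i <= n)%N -> X (Y i)];
       forall t : nat, (t <= n)%N -> exists Y : nat -> A,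
         [/\ exact_sequence n Y M, C (Y t)
           & forall i, (i <= n)%N -> i <> t -> X (Y i)]].
Proof.
have C0 : C zero_object.
  case: C_additive => _ /(_ 0%N (fun=> zero_object)); apply; last by case.
  exact: zero_direct_sum.
have up : exchangeable C C C X by apply: exchange_up X_gen_cogen.1.
have down : exchangeable C C X C by apply: exchange_down X_gen_cogen.2.
tfae.
- case/dim_leP => m le_mn /(exact_sequence_resolves m (fun=> C)) res_m.
  have {}res_m := resolves_pad (fun=> C0) (le_mn : m < n.+1)%N res_m.
  have /exact_sequence_resolves[Y [exY PY]] :=
    resolves_X_below up (leqnn n) res_m.
  exists Y; split=> // [|i lt_in].
    by have := PY n (leqnn n); rewrite /X_below ltnn.
  by have := PY i (ltnW lt_in); rewrite /X_below lt_in.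
- case=> Y [exY CYn XY].
  have : resolves n.+1 (X_except C X n) (0 : hom M zero_object).
    apply/resolves_X_exceptP => //; exists Y; split=> // i le_in /eqP neq_in.
    by apply: XY; rewrite ltn_neqAle neq_in.
  have to0 t : (t <= n)%N ->
      resolves n.+1 (X_except C X t) (0 : hom M zero_object) ->
      resolves n.+1 (X_except C X 0) (0 : hom M zero_object).
    elim: t => // t IHt lt_tn res_t1; apply: IHt (ltnW lt_tn) _.
    exact: resolves_X_except_down res_t1.
  move=> /(to0 n (leqnn n)) /resolves_X_exceptP [//|Y' [exY' CY0 XY']].
  exists Y'; split=> // i /andP[i_gt0 le_in]; apply: XY' => //.
  by apply/eqP; rewrite -lt0n.
- case=> Y [exY CY0 XY] t le_tn; apply/resolves_X_exceptP => //.
  elim: t le_tn => [|t IHt] le_tn.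
    apply/resolves_X_exceptP => //; exists Y; split=> // i le_in /eqP neq_i0.
    by apply: XY; rewrite lt0n neq_i0.
  exact: resolves_X_except_up (IHt (ltnW le_tn)).
- move=> /(_ 0%N isT)[Y [exY CY0 XY]]; apply/dim_leP; exists n => //.
  exists Y; split=> // i le_in; case: (eqVneq i 0%N) => [-> // | /eqP neq_i0].
  by apply: X_sub_C; apply: XY.
Qed.
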